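(* Let $P\in\mathcal{P}$ and $q\in Q$. Then $$S^-(q)-S^+(q)\equiv K(q)\pmod{M(q)}.$$
   Context: Graphs are finite and loopless but may have multiple edges. A plane triangulation is a plane graph all of whose faces (including the outer one) are bounded by cycles of length 3. $\mathcal{P}$ is the family of all 2-connected plane triangulations all of whose vertices have degree 3 or 6. $Q=\{0,1,2\}$ is the cyclic group of integers modulo 3. For $P\in\mathcal{P}$ fix a partition of the edge set into three classes indexed by $Q$ such that for every vertex $v$, if two edges are counterclockwise successive edges incident with $v$, then the first is of class $q$ and the second is of class $q+1$ for some $q\in Q$ (such a partition is known to exist, by Grünbaum and Motzkin). A subgraph is of class $q$ if all of its edges are of class $q$. It is known that the spanning subgraph $P_q$ formed by the edges of class $q$ consists of two induced paths (the maximal paths of class $q$, whose ends are the four vertices of degree 3) of the same length, denoted $M(q)$, and of $K(q)-1$ induced cycles of the same length $2M(q)$, where $K(q)$ is the distance in $P$ between the two maximal paths of class $q$. For a vertex $A$ of degree 3, $[A,q]$ denotes the maximal path of class $q$ having $A$ as an end, oriented as $v_0v_1\ldots v_{M(q)}$ with initial vertex $A=v_0$ and terminal vertex $A_q=v_{M(q)}$. An edge is adjacent to a path if it does not belong to the path but is incident with a vertex of it. An edge $e$ adjacent to $[A,q]$ at the vertex $v_j$ is a left branch of $[A,q]$ if either $0\le j<M(q)$ and $v_jv_{j+1},e$ are counterclockwise successive edges at $v_j$, or $0<j\le M(q)$ and $e,v_{j-1}v_j$ are counterclockwise successive edges at $v_j$; otherwise it is a right branch. Put $[A,q](e)=j$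 if $e$ is a left branch and $[A,q](e)=2M(q)-j$ if $e$ is a right branch. Let $A,C$ be ends of the two different maximal paths of class $q$. Let $f$ (respectively $g$) be the first edge of the oriented path $[C,q+1]$ (respectively $[C,q-1]$) which is adjacent to $[A,q]$. Then $S^+(q)=[A,q](f)$ if $f$ is a left branch of $[A,q]$ and $S^+(q)=[A,q](f)-M(q)$ if $f$ is a right branch; $S^-(q)=[A,q](g)$ if $g$ is a left branch of $[A,q]$ and $S^-(q)=[A,q](g)-M(q)$ if $g$ is a right branch. These values do not depend on the choice of $A$ and $C$, and $0\le S^+(q)<M(q)$, $0<S^-(q)\le M(q)$. *)

(* Defs.v *)
From HB Require Import structures.
From mathcomp Require Import all_boot all_order all_fingroup all_algebra.

Set Implicit Arguments.
Unset Strict Implicit.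
Unset Printing Implicit Defensive.

Import GRing.Theory.
Local Open Scope ring_scope.

(* A connected plane loopless multigraph with at least one edge, given by its
   rotation system. An edge is a pair {x, flip x} of opposite darts, the dart x
   running from src x to src (flip x). The permutation rot sends a dart to the
   next one counterclockwise around its source, so that flip * rot^-1
   (x |-> rot^-1 (flip x)) follows the boundary of the face on the left of a
   dart and its orbits are the faces. Planarity is Euler's formula V + F = E + 2
   (the number of edges being the number of orbits of flip). *)
Record plane_graph := PlaneGraph {
  vertex : finType;
  dart : finType;
  src : dart -> vertex;
  flip : {perm dart};
  rot : {perm dart};
  flipK : involutive flip;
  flip_neq : forall x, flip x != x;
  src_rot : forall x y, (src x == src y) = (y \in porbit rot x);
  src_flip_neq : forall x, src (flip x) != src x;
  graph_connected : forall u v : vertex,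
    connect [rel a b | [exists x, (src x == a) && (src (flip x) == b)]] u v;
  euler_formula :
    (#|vertex| + #|porbits (flip * rot^-1)%g| = #|porbits flip| + 2)%N
}.

Section PlaneGraph.

Variable P : plane_graph.
Implicit Types (x y f : dart P) (A B u v : vertex P) (p r : seq (dart P)).

Definition tgt x : vertex P := src (flip P x).

Definition adj : rel (vertex P) :=
  [rel u v | [exists x, (src x == u) && (tgt x == v)]].

Definition degree v : nat := #|[set x | src x == v]|.

Definition face : {perm dart P} := (flip P * (rot P)^-1)%g.

Definition two_connected : Prop :=
  (2 < #|vertex P|)%N /\
  forall w u v, u != w -> v != w ->
    connect [rel a b | [&& adj a b, a != w & b != w]] u v.

Definition triangulation : Prop :=
  forall x, #|porbit face x| = 3%N /\
            uniq [:: src x; src (face x); src (face (face x))].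

Definition in_family : Prop :=
  [/\ two_connected, triangulation & forall v, degree v \in [:: 3; 6]%N].

Definition edge_classes (c : dart P -> 'Z_3) : Prop :=
  (forall x, c (flip P x) = c x) /\ (forall x, c (rot P x) = c x + 1).

(* A walk starting at A, as the sequence of its darts in the direction of
   travel. *)
Fixpoint walk A p : bool :=
  if p is x :: p' then (src x == A) && walk (tgt x) p' else true.

Definition pverts A p : seq (vertex P) := A :: [seq tgt x | x <- p].

Definition pedges p : seq (dart P) := p ++ [seq flip P x | x <- p].

Definition class_path (c : dart P -> 'Z_3) (q : 'Z_3) A p : bool :=
  [&& walk A p, uniq (pverts A p) & all (fun x => c x == q) p].

Definition subpath A p B r : Prop :=
  {subset pverts A p <= pverts B r} /\ {subset pedges p <= pedges r}.

(* p is the oriented path [A,q]. The condition on degree A is needed: a cycle of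
   class q minus one edge is also maximal among the paths of class q. *)
Definition bracket (c : dart P -> 'Z_3) (q : 'Z_3) A p : Prop :=
  [/\ degree A = 3%N, class_path c q A p
    & forall B r, class_path c q B r -> subpath A p B r -> subpath B r A p].

Definition adjacent A p x : bool :=
  (x \notin pedges p) && ((src x \in pverts A p) || (tgt x \in pverts A p)).

Definition first_adjacent A p r f : Prop :=
  ohead [seq x <- r | adjacent A p x] = Some f.

(* The one of the two darts of the edge of x that leaves the path, when that
   edge is adjacent to the path. It is unambiguous for an induced path. *)
Definition branch_dart A p x : dart P :=
  if src x \in pverts A p then x else flip P x.

Definition branch_index A p x : nat :=
  index (src (branch_dart A p x)) (pverts A p).

Definition left_branch A p x : bool :=
  let y := branch_dart A p x in
  let j := branch_index A p x in
  (* v_j v_(j+1) is the dart nth _ p j; v_(j-1) v_j, seen from v_j, is the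
     reverse of the dart nth _ p j.-1 *)
  ((j < size p)%N && (rot P (nth y p j) == y)) ||
  ((0 < j <= size p)%N && (rot P y == flip P (nth y p j.-1))).

(* [A,q](e), e being the edge of x *)
Definition branch_value A p x : nat :=
  if left_branch A p x then branch_index A p x
  else (2 * size p - branch_index A p x)%N.

(* S^+(q) and S^-(q) are its values at the edges f and g respectively. *)
Definition branch_offset A p x : nat :=
  if left_branch A p x then branch_value A p x
  else (branch_value A p x - size p)%N.

(* k is the distance in P between two sets of vertices. *)
Definition is_distance (U W : seq (vertex P)) (k : nat) : Prop :=
  (exists u s, [/\ u \in U, path adj u s, last u s \in W & size s = k]) /\
  (forall u s, u \in U -> path adj u s -> last u s \in W -> (k <= size s)%N).

End PlaneGraph.

(* Main.v *)
(* P is the quotient of the triangular lattice by a group generated by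
   half-turns. Translations of the lattice act on the darts of P and preserve
   their classes; a half-turn about a vertex (the cube of rot) reverses them. Fix
   a dart x of class q at A, the degree 3 vertex from which [A,q] starts; it is
   fixed by the half-turn. Writing x(i,j) for its translate by i steps along x and
   j steps along the direction 60 degrees to the left, the lattice L of those
   (i,j) with x(i,j) = x determines P: every vertex is the source of some x(i,j),
   and the sources of x(i,j) and x(k,l) coincide iff (i,j) = (k,l) or
   (i,j) = -(k,l) modulo L. The path [A,q] is the image of the line j = 0, where L
   has period 2M. The second coordinates of L form some 2hZ and C is the source of
   x(s,-h) for some s, so the two paths of class q are at distance K = h. From
   there the class q+1 direction reaches the line j = 0 at (s,0), and the class
   q-1 direction at (s-h,0), so that S^+ = -s and S^- = h-s modulo M. *)

Require Import Defs.
From mathcomp Require Import all_boot all_order all_fingroup all_algebra.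
From mathcomp Require Import cyclic zify.

Set Implicit Arguments.
Unset Strict Implicit.
Unset Printing Implicit Defensive.

Import GRing.Theory.
Local Open Scope ring_scope.

(** * Integer divisibility and powers with integer exponents *)

Lemma dvdz_small (N : nat) (t : int) : (N%:Z %| t)%Z -> (`|t| < N)%N -> t = 0.
Proof.
rewrite /dvdz absz_nat => Nt tN; apply/eqP; rewrite -absz_eq0.
by apply: contraLR tN; rewrite -lt0n -leqNgt => t0; apply: dvdn_leq.
Qed.

Section IntPowers.

Local Open Scope group_scope.

Variable gT : finGroupType.
Implicit Types x y : gT.

(** Reducing the exponent modulo the order gives a natural power for either sign of [n]. *)
Definition zexpg x (n : int) : gT := x ^+ `|(n %% #[x])%Z|.

Lemma zexpg_nat x (n : nat) : zexpg x n = x ^+ n.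
Proof. by rewrite /zexpg modz_nat absz_nat expg_mod_order. Qed.

Lemma zexpgD x (m n : int) : zexpg x (m + n)%R = zexpg x m * zexpg x n.
Proof.
rewrite /zexpg -expgD; apply/eqP; rewrite eq_expg_mod_order.
have o_gt0 := order_gt0 x; set o := #[x] in o_gt0 *.
have [k km] : exists k : int, m = (k * o%:Z + `|(m %% o)%Z|%:Z)%R.
  by exists (m %/ o)%Z; rewrite gez0_abs ?modz_ge0 -?divz_eq //; lia.
have [l ln] : exists k : int, n = (k * o%:Z + `|(n %% o)%Z|%:Z)%R.
  by exists (n %/ o)%Z; rewrite gez0_abs ?modz_ge0 -?divz_eq //; lia.
rewrite {1}km {1}ln addrACA -mulrDl modzMDl -PoszD modz_nat absz_nat.
by rewrite modn_mod.
Qed.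

Lemma zexpgN x (n : int) : zexpg x (- n)%R = (zexpg x n)^-1.
Proof.
by apply/eqP; rewrite eq_sym eq_invg_mul -zexpgD subrr (zexpg_nat x 0).
Qed.

Lemma zexpgJ x y (n : int) : zexpg x n ^ y = zexpg (x ^ y) n.
Proof. by rewrite /zexpg orderJ conjXg. Qed.

Lemma zexpVg x (n : int) : zexpg x^-1 n = zexpg x (- n)%R.
Proof. by rewrite zexpgN /zexpg orderV expgVn. Qed.

Lemma commute_zexpg x y (m n : int) :
  commute x y -> commute (zexpg x m) (zexpg y n).
Proof. exact: commuteX2. Qed.

End IntPowers.

(** * Translations in a group satisfying the relations of the (2,3,6) rotation group *)

Section TriangleGroup.

Local Open Scope group_scope.

Variables (gT : finGroupType) (f r : gT).
Hypotheses (f2 : f * f = 1) (r6 : r ^+ 6 = 1) (fr3 : (f * r^-1) ^+ 3 = 1).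

(* With r and f the permutations rot and flip of the darts (products act from
   left to right), east moves a dart one step straight ahead, and northeast moves it
   one step in the direction of its image under rot. *)
Definition east : gT := f * r ^+ 3.
Definition northeast : gT := east ^ r^-1.

Lemma eastJ : east ^ (r ^+ 3) = east^-1.
Proof.
have : r ^+ 3 * r ^+ 3 = 1 by rewrite -expgD.
rewrite /east; move: (r ^+ 3) => s ss1.
rewrite /conjg invMg -!mulgA ss1 mulg1; congr (_ * _).
by apply/eqP; rewrite eq_sym eq_invg_mul f2.
Qed.

Lemma r3VC : r^-1 * r ^+ 3 = r ^+ 3 * r^-1.
Proof. exact/commute_sym/commuteV/commute_sym/commuteX. Qed.

Lemma northeastJ : northeast ^ (r ^+ 3) = northeast^-1.
Proof. by rewrite /northeast -conjgM r3VC conjgM eastJ conjVg. Qed.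

Lemma northeastVE : northeast^-1 = east ^ (r ^+ 2).
Proof. by rewrite -northeastJ /northeast -conjgM (expgS r 2) mulKg. Qed.

(** With [u = r ^+ 2], the face relation reads [(east * u) ^+ 3 = 1]: the translations along the
    three sides of a triangle multiply to 1, and by [northeastVE] the third one is
    [northeast^-1]. *)
Lemma northeastE : northeast = east * east ^ (r ^- 2).
Proof.
have uuu1 : r ^+ 2 * (r ^+ 2 * r ^+ 2) = 1 by rewrite -!expgD.
have au : east * r ^+ 2 = f * r^-1.
  have rV : r^-1 = r ^+ 3 * r ^+ 2.
    by apply/eqP; rewrite eq_invg_mul -expgD -expgS r6.
  by rewrite /east -mulgA -rV.
apply: invg_inj; rewrite northeastVE.
move: au uuu1; move: (r ^+ 2) => u; move: east => a au uuu1.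
have uV : u^-1 = u * u by apply/eqP; rewrite eq_invg_mul uuu1.
apply/eqP; rewrite eq_sym eq_invg_mul /conjg invgK uV.
rewrite -!mulgA (_ : u * (u * (u * (a * u))) = a * u).
  by rewrite !mulgA -!(mulgA _ a u) au -mulgA; apply/eqP.
by rewrite !mulgA -(mulgA u) uuu1 mul1g.
Qed.

(** Conjugation by [r ^+ 3] inverts [east], [w] and their product [northeast]. Inverting a product
    together with both factors forces the factors to commute. *)
Lemma commute_east_northeast : commute east northeast.
Proof.
set w := east ^ (r ^- 2).
have wJ : w ^ (r ^+ 3) = w^-1.
  rewrite /w -conjgM (_ : r ^- 2 * r ^+ 3 = r ^+ 3 * r ^- 2).
    by rewrite conjgM eastJ conjVg.
  exact/commute_sym/commuteV/commuteX2/commute_refl.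
have : northeast^-1 = (w * east)^-1.
  by rewrite -northeastJ northeastE -/w conjMg eastJ wJ [RHS]invMg.
by move/invg_inj; rewrite northeastE -/w /commute => {1}->; rewrite !mulgA.
Qed.

Lemma mul_rf : r * f = northeast * r ^+ 3 * r.
Proof.
have : r ^+ 3 * r ^+ 3 = 1 by rewrite -expgD.
rewrite /northeast /conjg invgK /east.
have := r3VC; move: (r ^+ 3) => s rs ss1.
by rewrite -!mulgA (mulgA r^-1) rs -!mulgA mulVg mulg1 ss1 mulg1.
Qed.

Lemma mul_r2f : r ^+ 2 * f = east^-1 * northeast * r ^+ 3 * r ^+ 2.
Proof.
have : r ^+ 3 * r ^+ 3 = 1 by rewrite -expgD.
rewrite northeastE mulKg /conjg invgK /east.
have : commute (r ^- 2) (r ^+ 3) 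
  by exact/commute_sym/commuteV/commuteX2/commute_refl.
rewrite /commute; move: (r ^+ 3) (r ^+ 2) => s u us ss1.
by rewrite -!mulgA (mulgA u^-1) us -!mulgA mulVg mulg1 ss1 mulg1.
Qed.

Lemma flipE : f = east * r ^+ 3.
Proof. by rewrite /east -mulgA -expgD r6 mulg1. Qed.

End TriangleGroup.

(** * Lattice coordinates on the darts *)

Section Charts.

Local Notation rot := Defs.rot.

Variable P : plane_graph.
Hypothesis P_family : in_family P.
Implicit Types (x y z : dart P) (v : vertex P) (i j k l : int).

Local Notation a := (east (flip P) (rot P)).
Local Notation b := (northeast (flip P) (rot P)).

Lemma flip_mulg : (flip P * flip P = 1)%g.
Proof. by apply/permP=> x; rewrite permM perm1 flipK. Qed.

Lemma degree_src x : degree (src x) = #|porbit (rot P) x|.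
Proof.
by apply: eq_card => y; rewrite inE eq_sym src_rot.
Qed.

(** Both possible degrees, 3 and 6, divide 6. *)
Lemma rot6 : (rot P ^+ 6 = 1)%g.
Proof.
apply/permP=> x; rewrite perm1 permX.
have [_ _ /(_ (src x))] := P_family.
rewrite degree_src !inE => /orP[] /eqP o; have := iter_porbit (rot P) x.
  by rewrite o => x3; rewrite (iterD 3 3) !x3.
by rewrite o.
Qed.

Lemma face3 : ((flip P * (rot P)^-1) ^+ 3 = 1)%g.
Proof.
apply/permP=> x; rewrite perm1 permX.
have [_ /(_ x)[o _] _] := P_family.
by rewrite -{1}o iter_porbit.
Qed.

Lemma rot3_degree3 x : degree (src x) = 3%N -> (rot P ^+ 3)%g x = x.
Proof. by rewrite degree_src permX => {1}<-; rewrite iter_porbit. Qed.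

Lemma rot3KX n x :
  (rot P ^+ 3)%g ((rot P ^+ n)%g ((rot P ^+ 3)%g x)) = (rot P ^+ n)%g x.
Proof.
rewrite -!permM -!expgD (_ : 3 + (n + 3) = 6 + n)%N; last by lia.
by rewrite expgD rot6 mul1g.
Qed.

Lemma src_rotX n x : src ((rot P ^+ n)%g x) = src x.
Proof. by apply/esym/eqP; rewrite src_rot mem_porbit. Qed.

Lemma src_eq_rotX x y :
  src x = src y -> exists2 n, (n < 6)%N & y = (rot P ^+ n)%g x.
Proof.
move=> /eqP; rewrite src_rot => /porbitP[n ->].
by exists (n %% 6)%N; rewrite ?ltn_pmod // (expg_mod _ rot6).
Qed.

(* The translate of x by i steps straight ahead and j steps in the direction of
   rot x. *)
Definition dart_at x i j : dart P := (zexpg a i * zexpg b j)%g x.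

Lemma dart_at0 x : dart_at x 0 0 = x.
Proof. by rewrite /dart_at !(zexpg_nat _ 0) mulg1 perm1. Qed.

(** As the two translations commute, the additive group of pairs of integers acts on the darts. *)
Lemma dart_atD x i j k l :
  dart_at (dart_at x i j) k l = dart_at x (i + k) (j + l).
Proof.
rewrite /dart_at -permM !zexpgD; congr (fun_of_perm _ _).
have := commute_zexpg k j (commute_east_northeast flip_mulg rot6 face3).
rewrite /commute => ab.
by rewrite -!mulgA (mulgA (zexpg b j)) -ab !mulgA.
Qed.

Lemma dart_at_rot3 x i j :
  (rot P ^+ 3)%g (dart_at x i j) = dart_at ((rot P ^+ 3)%g x) (- i) (- j).
Proof.
rewrite /dart_at -!permM; congr (fun_of_perm _ _).
rewrite conjgC conjMg !zexpgJ (eastJ flip_mulg rot6).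
by rewrite (northeastJ flip_mulg rot6) !zexpVg.
Qed.

Lemma east_dart_at x n : iter n a x = dart_at x n%:Z 0.
Proof. by rewrite -permX /dart_at zexpg_nat (zexpg_nat _ 0) mulg1. Qed.

Lemma flip_dart_at x i j :
  flip P (dart_at x i j) = (rot P ^+ 3)%g (dart_at x (i + 1) j).
Proof.
rewrite -[in RHS](addr0 j) -dart_atD {1}(flipE (flip P) rot6) permM.
by rewrite -(east_dart_at _ 1).
Qed.

Lemma flip_rot_dart_at x i j :
  flip P (rot P (dart_at x i j)) =
  rot P ((rot P ^+ 3)%g (dart_at x i (j + 1))).
Proof.
rewrite -[in RHS](addr0 i) -dart_atD -permM (mul_rf _ rot6) 2!permM.
by rewrite /dart_at [zexpg _ 0](zexpg_nat _ 0) [zexpg _ 1](zexpg_nat _ 1) mul1g.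
Qed.

Lemma flip_rot2_dart_at x i j :
  flip P ((rot P ^+ 2)%g (dart_at x i j)) =
  (rot P ^+ 2)%g ((rot P ^+ 3)%g (dart_at x (i - 1) (j + 1))).
Proof.
rewrite -dart_atD -permM (mul_r2f flip_mulg rot6 face3) permM
  [(_ * rot P ^+ 3)%g _]permM.
by rewrite /dart_at zexpgN [zexpg a 1](zexpg_nat _ 1)
  [zexpg b 1](zexpg_nat _ 1).
Qed.

(** Describes the straight walks that climb from a dart turned by [rot]; the next such lemma does
    the same for [rot ^+ 2]. *)
Lemma east_rot_dart_at x n i j :
  iter n a (rot P (dart_at x i j)) = rot P (dart_at x i (j + n%:Z)).
Proof.
elim: n => [|n IHn]; first by rewrite addr0.
rewrite iterS IHn /east permM flip_rot_dart_at (rot3KX 1).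
by rewrite -addrA -PoszD addn1.
Qed.

Lemma east_rot2_dart_at x n i j :
  iter n a ((rot P ^+ 2)%g (dart_at x i j)) =
  (rot P ^+ 2)%g (dart_at x (i - n%:Z) (j + n%:Z)).
Proof.
elim: n => [|n IHn]; first by rewrite subr0 addr0.
rewrite iterS IHn /east permM flip_rot2_dart_at.
rewrite rot3KX; congr (fun_of_perm _ (dart_at _ _ _)); lia.
Qed.

Lemma tgt_east x : tgt x = src (a x).
Proof. by rewrite /east permM src_rotX. Qed.

(** * Edge classes and the straightness of class paths *)

Section Classes.

Variable c : dart P -> 'Z_3.
Hypothesis c_classes : edge_classes c.

Lemma class_flip x : c (flip P x) = c x.
Proof. by case: c_classes. Qed.

Lemma class_rotX n x : c ((rot P ^+ n)%g x) = c x + n%:R.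
Proof.
rewrite permX; elim: n => [|n IHn]; first by rewrite addr0.
by case: c_classes => _ /= ->; rewrite IHn -addrA natr1.
Qed.

Lemma class_east x : c (a x) = c x.
Proof.
rewrite /east permM class_rotX class_flip (_ : 3%:R = 0) ?addr0 //.
exact/val_inj.
Qed.

Lemma class_dart_at x i j : c (dart_at x i j) = c x.
Proof.
have expC (s : {perm dart P}) k :
  (forall y, c (s y) = c y) -> forall y, c (zexpg s k y) = c y.
  move=> sC y; rewrite /zexpg permX; elim: `|_|%N => //= n.
  by rewrite sC.
rewrite /dart_at permM !expC // => y; first exact: class_east.
rewrite /northeast /conjg invgK 2!permM.
have rV z : c ((rot P)^-1%g z) = c z - 1.
  rewrite -{2}[z](permKV (rot P)) -[rot P _]/((rot P ^+ 1)%g _).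
  by rewrite class_rotX addrK.
rewrite rV class_east.
by rewrite -[rot P _]/((rot P ^+ 1)%g _) class_rotX addrK.
Qed.

(** [rot ^+ n] adds [n] to the class, and below 6 only 0 and 3 vanish modulo 3. *)
Lemma src_class_inj x y :
  src x = src y -> c x = c y -> y = x \/ y = (rot P ^+ 3)%g x.
Proof.
move=> /src_eq_rotX[n n6 ->] /esym; rewrite class_rotX -[RHS]addr0.
move/addrI; case: n n6 => [|[|[|[|[|[|]]]]]] //= _ /eqP e //; last by right.
by left; rewrite perm1.
Qed.

Lemma class_dart v q : exists2 x, src x = v & c x = q.
Proof.
have [_ _ /(_ v)] := P_family; rewrite /degree.
have [->|/set0Pn[x]] := eqVneq [set x | src x == v] set0.
  by rewrite cards0.
rewrite inE => /eqP xv _.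
exists ((rot P ^+ (q - c x)%R)%g x).
  by rewrite src_rotX.
by rewrite class_rotX natr_Zp addrC subrK.
Qed.

Lemma walk_traject x n : walk (src x) (traject a x n).
Proof. by elim: n x => //= n IHn x; rewrite eqxx tgt_east IHn. Qed.

Lemma pverts_traject x n :
  pverts (src x) (traject a x n) = map (@src P) (traject a x n.+1).
Proof.
rewrite /pverts trajectS map_cons; congr (_ :: _).
by elim: n x => //= n IHn x; rewrite tgt_east IHn.
Qed.

Lemma class_path_traject x n :
  class_path c (c x) (src x) (traject a x n) =
  uniq (map (@src P) (traject a x n.+1)).
Proof.
rewrite /class_path walk_traject pverts_traject /=.
rewrite (_ : all _ _ = true) ?andbT //; apply/allP=> _ /trajectP[k _ ->].
by rewrite east_dart_at class_dart_at.
Qed.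

(** At [tgt y] the darts of the class of [y] are [flip y], which returns to the visited vertex
    [src y], and its half-turn [east y]. So a class path never bends. *)
Lemma walk_from_tgt y p :
  walk (tgt y) p -> uniq (src y :: pverts (tgt y) p) ->
  all (fun z => c z == c y) p -> p = traject a (a y) (size p).
Proof.
elim: p y => // z p IHp y /andP[/eqP zy z_p] /andP[yNp p_uniq].
move=> /andP[/eqP cz cp].
have zE : z = a y.
  have src_fy : src (flip P y) = src z := esym zy.
  have [e|->] := src_class_inj src_fy (etrans (class_flip y) (esym cz)).
    by move: yNp; rewrite e /pverts /tgt /= flipK !inE eqxx orbT.
  by rewrite /east [RHS]permM.
have pE : p = traject a (a z) (size p) by apply: IHp; rewrite ?cz ?zy.
by rewrite /= -zE -pE.
Qed.

Lemma class_path_from x p :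
  (rot P ^+ 3)%g x = x -> class_path c (c x) (src x) p ->
  p = traject a x (size p).
Proof.
case: p => // z p x3 /and3P[/andP[/eqP zx z_p] p_uniq /andP[/eqP cz cp]].
have zE : z = x by have [|->] := src_class_inj (esym zx) (esym cz).
have pE : p = traject a (a z) (size p) by apply: walk_from_tgt; rewrite ?cz ?zx.
by rewrite /= -zE -pE.
Qed.

Lemma dart_at_shift x i j k l s t :
  dart_at x i j = dart_at x k l ->
  dart_at x (i + s) (j + t) = dart_at x (k + s) (l + t).
Proof. by move=> e; rewrite -!dart_atD e. Qed.

(** * Coordinates centred at a vertex of degree 3 *)

Section HalfTurn.

(* The half-turn about the source of x fixes x: this holds iff src x has
   degree 3. *)
Variable x : dart P.
Hypothesis x_half : (rot P ^+ 3)%g x = x.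

Lemma rot3_dart_at i j : (rot P ^+ 3)%g (dart_at x i j) = dart_at x (- i) (- j).
Proof. by rewrite dart_at_rot3 x_half. Qed.

Lemma src_dart_atN i j : src (dart_at x (- i) (- j)) = src (dart_at x i j).
Proof. by rewrite -rot3_dart_at src_rotX. Qed.

Lemma src_dart_at_inj i j k l :
  src (dart_at x i j) = src (dart_at x k l) ->
  dart_at x k l = dart_at x i j \/ dart_at x k l = dart_at x (- i) (- j).
Proof.
move/src_class_inj; rewrite !class_dart_at => /(_ erefl).
by rewrite rot3_dart_at.
Qed.

Lemma flip_dart_at_half i j :
  flip P (dart_at x i j) = dart_at x (- i - 1) (- j).
Proof. by rewrite flip_dart_at rot3_dart_at opprD. Qed.

(** With period [2i+1] on the line, the formula for [flip] would make [dart_at x i 0] a fixed point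
    of [flip]. *)
Lemma dart_at_odd i : dart_at x (i + i + 1) 0 <> x.
Proof.
rewrite -[RHS]dart_at0 => /(@dart_at_shift _ _ _ _ _ (- i - 1) 0) e.
have /eqP := flip_neq (dart_at x i 0); apply.
rewrite flip_dart_at_half oppr0.
rewrite -[RHS](_ : dart_at x (i + i + 1 + (- i - 1)) (0 + 0) = _).
  by rewrite e !add0r.
by congr dart_at; lia.
Qed.

Variables (A : vertex P) (q : 'Z_3) (p : seq (dart P)).
Hypotheses (x_src : src x = A) (x_class : c x = q).
Hypothesis p_bracket : bracket c q A p.

Lemma bracket_traject : p = traject a x (size p).
Proof.
case: p_bracket => _ p_path _; apply: class_path_from => //.
by rewrite x_src x_class.
Qed.

Lemma bracket_inj (i j : nat) :
  (i <= size p)%N -> (j <= size p)%N ->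
  src (dart_at x i%:Z 0) = src (dart_at x j%:Z 0) -> i = j.
Proof.
case: p_bracket => _ p_path _; move: p_path.
rewrite bracket_traject size_traject -x_src -x_class class_path_traject.
move=> p_uniq ip jp e; apply/eqP.
rewrite -(nth_uniq A _ _ p_uniq) ?size_map ?size_traject ?ltnS //.
rewrite !(nth_map x) ?size_traject ?ltnS // !nth_traject ?ltnS //.
by rewrite !east_dart_at e.
Qed.

Lemma src_dart_at_refl i j :
  dart_at x (i + j) 0 = x -> src (dart_at x i 0) = src (dart_at x j 0).
Proof.
rewrite -{2}[x]dart_at0 => /(@dart_at_shift _ _ _ _ _ (- j) 0).
by rewrite addrK (addr0 0) add0r => ->; rewrite -[in LHS]oppr0 src_dart_atN.
Qed.

(** The line folds back at the end of the path, and after [2 * size p] steps it is again at its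
    initial dart. *)
Lemma bracket_end : (0 < size p)%N /\ dart_at x (2 * size p)%:Z 0 = x.
Proof.
set m := size p.
(* By maximality the path prolonged by one step repeats a vertex, and the repetition must involve
   the new one. *)
have [i im /src_dart_at_inj e] : exists2 i : nat, (i <= m)%N &
    src (dart_at x i%:Z 0) = src (dart_at x m.+1%:Z 0).
  case: p_bracket => _ /and3P[_ p_uniq _] p_max.
  have [r_path|] := boolP (class_path c q A (traject a x m.+1)).
    have [|r_sub _] := p_max _ _ r_path.
      rewrite [in X in subpath _ X]bracket_traject -/m -x_src; split=> z.
        rewrite !pverts_traject [traject a x m.+2]trajectSr map_rcons.
        by rewrite mem_rcons inE => ->; rewrite orbT.
      rewrite /pedges trajectSr map_rcons !mem_cat !mem_rcons !inE.
      by move=> /orP[] ->; rewrite ?orbT.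
    have /and3P[_ r_uniq _] := r_path.
    have := uniq_leq_size r_uniq r_sub.
    by rewrite /= !size_map size_traject -/m ltnn.
  rewrite -x_src -x_class class_path_traject => /(uniqPn A)[i [j [ij]]].
  rewrite size_map size_traject ltnS => jm.
  have im1 : (i <= m.+1)%N := leq_trans (ltnW ij) jm.
  rewrite !(nth_map x) ?size_traject ?ltnS // !nth_traject ?ltnS //.
  rewrite !east_dart_at => e.
  have [jm' | mj] := leqP j m.
    have /eqP := bracket_inj (leq_trans (ltnW ij) jm') jm' e.
    by rewrite ltn_eqF.
  by exists i; [lia | rewrite e (_ : j = m.+1) //; lia].
have close s t : dart_at x s 0 = dart_at x t 0 -> dart_at x (s - t) 0 = x.
  move/(@dart_at_shift _ _ _ _ _ (- t) 0).
  by rewrite (addr0 0) (subrr t) dart_at0.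
(* Either [m.+1 - i] or [m.+1 + i] is a period. Reflection in that period identifies vertices of the
   path, so injectivity, with [dart_at_odd] against odd periods, leaves only [2m]. *)
have [] := e; rewrite ?oppr0 => /close {}e.
  case: i => [|i] in im e *.
    have m_gt0 : (0 < m)%N.
      case: m e {im} => // e; case: (@dart_at_odd 0).
      by rewrite -{2}e; congr dart_at.
    have m1 : m = 1%N.
      apply: bracket_inj => //; apply: src_dart_at_refl; rewrite -{2}e.
      by congr dart_at; lia.
    by split=> //; rewrite -{2}e m1; congr dart_at.
  have : (m - i)%N = 0%N.
    apply: bracket_inj => //; first exact: leq_subr.
    by apply: src_dart_at_refl; rewrite -{2}e; congr dart_at; lia.
  by move=> m0; move: im; rewrite -subn_gt0 m0.
have [i_m|i_neq_m] := eqVneq i m.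
  by case: (@dart_at_odd m); rewrite -{2}e i_m; congr dart_at; lia.
have m_i : m = i.+1.
  apply: bracket_inj => //; first by rewrite ltn_neqAle i_neq_m.
  by apply: src_dart_at_refl; rewrite -{2}e; congr dart_at; lia.
by split; rewrite ?m_i // -{2}e m_i; congr dart_at; lia.
Qed.

Lemma bracket_period i : dart_at x i 0 = x <-> ((2 * size p)%:Z %| i)%Z.
Proof.
have [m_gt0 m_end] := bracket_end.
set m := size p in m_gt0 m_end *.
have period k : dart_at x (k * (2 * m)%:Z) 0 = x.
  have pos n : dart_at x (n%:Z * (2 * m)%:Z) 0 = x.
    elim: n => [|n IHn]; first by rewrite mul0r dart_at0.
    by rewrite -{2}IHn -[in RHS]m_end dart_atD; congr dart_at; lia.
  case: k => n; first exact: pos.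
  rewrite -[x in dart_at x](pos n.+1) dart_atD -[RHS]dart_at0.
  congr dart_at; lia.
split=> [ix|/dvdzP[k ->]]; last exact: period.
have m2_neq0 : (2 * m)%:Z != 0 by lia.
have [k [j [jm iE]]] : exists k : int, exists j : nat,
    (j < 2 * m)%N /\ i = k * (2 * m)%:Z + j%:Z.
  exists (i %/ (2 * m)%:Z)%Z, `|(i %% (2 * m)%:Z)%Z|%N.
  rewrite gez0_abs ?modz_ge0 // -divz_eq; split=> //.
  by rewrite -ltz_nat gez0_abs ?modz_ge0 // ltz_pmod //; lia.
have jx : dart_at x j%:Z 0 = x.
  by rewrite -[x in LHS](period k) dart_atD addr0 -iE.
suff j0 : j = 0%N by rewrite iE j0 addr0 dvdz_mull.
have [j_m|m_j] := leqP j m.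
  by apply: bracket_inj => //; rewrite jx dart_at0.
(* A period [j] strictly between [m] and [2m] reflects to [2m - j], an index within the path whose
   vertex would be the initial one. *)
have : (2 * m - j)%N = 0%N.
  apply: bracket_inj => //; first by lia.
  rewrite -[RHS](_ : src (dart_at x j%:Z 0) = _); last by rewrite jx dart_at0.
  by apply: src_dart_at_refl; rewrite -{2}m_end; congr dart_at; lia.
lia.
Qed.

Lemma dart_at_reduce i :
  exists2 n : nat, (n < 2 * size p)%N & dart_at x i 0 = dart_at x n%:Z 0.
Proof.
have [m_gt0 _] := bracket_end.
have m2_neq0 : (2 * size p)%:Z != 0 by lia.
exists `|(i %% (2 * size p)%:Z)%Z|%N.
  by rewrite -ltz_nat gez0_abs ?modz_ge0 // ltz_pmod //; lia.
rewrite gez0_abs ?modz_ge0 //.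
have /bracket_period e : ((2 * size p)%:Z %| i - (i %% (2 * size p)%:Z)%Z)%Z.
  by rewrite {1}(divz_eq i (2 * size p)%:Z) addrK dvdz_mull.
rewrite -[x in RHS]e dart_atD; congr dart_at; lia.
Qed.

Lemma nth_bracket z (n : nat) : (n < size p)%N -> nth z p n = dart_at x n%:Z 0.
Proof.
move=> np; rewrite (set_nth_default x) // bracket_traject nth_traject //.
by rewrite east_dart_at.
Qed.

Lemma nth_pverts_bracket v (n : nat) :
  (n <= size p)%N -> nth v (pverts A p) n = src (dart_at x n%:Z 0).
Proof.
move=> np; rewrite bracket_traject -x_src pverts_traject.
rewrite (nth_map x) ?size_traject //.
by rewrite nth_traject // east_dart_at.
Qed.

Lemma size_pverts : size (pverts A p) = (size p).+1.
Proof. by rewrite /= size_map. Qed.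

Lemma mem_pverts_bracket v :
  v \in pverts A p <-> exists i, v = src (dart_at x i 0).
Proof.
split=> [/(nthP A)[n]|[i ->]].
  rewrite size_pverts ltnS => np; rewrite nth_pverts_bracket // => <-.
  by exists n%:Z.
have [n n2 ->] := dart_at_reduce i.
have memv (k : nat) : (k <= size p)%N -> src (dart_at x k%:Z 0) \in pverts A p.
  by move=> kp; rewrite -(nth_pverts_bracket A) // mem_nth // size_pverts.
have [|np] := leqP n (size p); first exact: memv.
have [_ p_end] := bracket_end.
rewrite (src_dart_at_refl (j := (2 * size p - n)%:Z)).
  by apply: memv; lia.
by rewrite -{2}p_end; congr dart_at; lia.
Qed.

(** One period of the line runs along the path and back: the first [size p] darts are those of [p],
    the others their flips. *)
Lemma mem_pedges_bracket z :
  z \in pedges p <-> exists i, z = dart_at x i 0.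
Proof.
rewrite mem_cat; split=> [/orP[/(nthP z)|/(nthP z)]|].
- by case=> n np <-; exists n%:Z; rewrite nth_bracket.
- case=> n; rewrite size_map => np <-; exists (- n%:Z - 1).
  by rewrite (nth_map z) // nth_bracket // flip_dart_at_half oppr0.
case=> i ->; have [n n2 ->] := dart_at_reduce i.
have mem_p (k : nat) : (k < size p)%N -> dart_at x k%:Z 0 \in p.
  by move=> kp; rewrite -(nth_bracket x) // mem_nth.
have [/mem_p->//|np] := ltnP n (size p); apply/orP; right.
apply/mapP; exists (dart_at x (2 * size p - n.+1)%:Z 0).
  by apply: mem_p; lia.
rewrite flip_dart_at_half oppr0; have [_ p_end] := bracket_end.
rewrite -[x in RHS]p_end dart_atD; congr dart_at; lia.
Qed.

(** The projection to the second coordinate of the lattice of periods of [x]. *)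
Definition on_bracket_height j := exists i, dart_at x i j = x.

(** A vertex of row [j] coincides with one of row 0 only through a period of height [j], up to the
    sign of the row 0 coordinate; such a period carries the whole row onto the path. *)
Lemma src_dart_at_mem_pverts i j :
  src (dart_at x i j) \in pverts A p <-> on_bracket_height j.
Proof.
rewrite mem_pverts_bracket; split=> [[k /esym/src_dart_at_inj[]]|[k]].
- move/(@dart_at_shift _ _ _ _ _ (- k) 0); rewrite subrr !addr0 dart_at0 => e.
  by exists (i - k).
- rewrite oppr0 => /(@dart_at_shift _ _ _ _ _ k 0).
  rewrite addNr !addr0 dart_at0 => e.
  by exists (i + k).
- rewrite -[RHS]dart_at0 => /(@dart_at_shift _ _ _ _ _ (i - k) 0) e.
  exists (i - k); congr src.
  rewrite -[RHS](_ : dart_at x (0 + (i - k)) (0 + 0) = _).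
    by rewrite -e; congr dart_at; lia.
  by rewrite add0r.
Qed.

Lemma on_bracket_heightB j k :
  on_bracket_height j -> on_bracket_height k -> on_bracket_height (j - k).
Proof.
move=> [i1 e1] [i2 e2]; exists (i1 - i2).
move: e1; rewrite -{2}e2 => /(@dart_at_shift _ _ _ _ _ (- i2) (- k)).
by rewrite !subrr dart_at0.
Qed.

Lemma on_bracket_height_period :
  exists2 N : nat, (0 < N)%N & forall j, on_bracket_height j <-> (N%:Z %| j)%Z.
Proof.
have H0 : on_bracket_height 0 by exists 0; rewrite dart_at0.
have HN j : on_bracket_height j -> on_bracket_height (- j).
  by rewrite -(add0r (- j)); apply: on_bracket_heightB.
have HD j k :
    on_bracket_height j -> on_bracket_height k -> on_bracket_height (j + k).
  move=> hj hk; rewrite -(opprK k).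
  by apply: on_bracket_heightB => //; apply: HN.
(* Restating the height condition by an orbit of [east] makes it decidable, as [ex_minnP]
   requires. *)
have HP n : reflect (on_bracket_height n%:Z) (dart_at x 0 n%:Z \in porbit a x).
  apply: (iffP idP) => [/porbitP[k]|[i e]].
    rewrite permX east_dart_at => /(@dart_at_shift _ _ _ _ _ (- k%:Z) 0).
    by rewrite subrr !addr0 dart_at0 => e; exists (0 - k%:Z).
  rewrite porbit_sym; apply/porbitP; exists `|(i %% #[a]%g%:Z)%Z|%N.
  rewrite -{1}e -[RHS]/(zexpg a i (dart_at x 0 n%:Z)) /dart_at.
  rewrite (zexpg_nat _ 0) mul1g permM.
  have := commute_zexpg i n%:Z (commute_east_northeast flip_mulg rot6 face3).
  by rewrite /commute -!permM => ->.
have [|N /andP[N_gt0 /HP hN] N_min] :=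
    @ex_minnP (fun n => (0 < n)%N && (dart_at x 0 n%:Z \in porbit a x)).
  (* Translating by the order of [northeast] is trivial, so this order is a positive height. *)
  exists #[b]%g; rewrite order_gt0 (_ : dart_at _ _ _ = x) ?porbit_id //.
  by rewrite /dart_at (zexpg_nat _ 0) mul1g zexpg_nat expg_order perm1.
exists N => // j.
have hM k : on_bracket_height (k * N%:Z).
  have pos n : on_bracket_height (n%:Z * N%:Z).
    elim: n => [|n IHn]; first by rewrite mul0r.
    by rewrite -addn1 PoszD mulrDl mul1r; apply: HD.
  by case: k => n //; rewrite NegzE mulNr; apply: HN.
split=> [hj|/dvdzP[k ->] //].
have N_neq0 : N%:Z != 0 by lia.
have hr : on_bracket_height `|(j %% N%:Z)%Z|%N.
  rewrite gez0_abs ?modz_ge0 //.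
  have -> : (j %% N%:Z)%Z = j - (j %/ N%:Z)%Z * N%:Z.
    by rewrite {2}(divz_eq j N%:Z) addrC addKr.
  exact: on_bracket_heightB.
have r_lt : (`|(j %% N%:Z)%Z| < N)%N.
  by rewrite -ltz_nat gez0_abs ?modz_ge0 // ltz_pmod //; lia.
have [r0|r_gt0] := posnP `|(j %% N%:Z)%Z|%N.
  by apply/dvdz_mod0P/eqP; rewrite -absz_eq0 r0.
have := N_min `|(j %% N%:Z)%Z|%N; rewrite r_gt0 /=.
by move=> /(_ (introT (HP _) hr)); rewrite leqNgt r_lt.
Qed.

Lemma adj_dart_at i j v :
  adj (src (dart_at x i j)) v ->
  exists i' j', v = src (dart_at x i' j') /\ `|j' - j| <= 1.
Proof.
move=> /existsP[z /andP[/eqP zu /eqP <-]] {v}.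
have out k l : forall n, (n < 3)%N -> exists k' l',
    tgt ((rot P ^+ n)%g (dart_at x k l)) = src (dart_at x k' l') /\
    `|l' - l| <= 1.
  case=> [|[|[|//]]] _; rewrite /tgt.
  - rewrite perm1 flip_dart_at src_rotX.
    by exists (k + 1), l; split=> //; lia.
  - rewrite -[(rot P ^+ 1)%g _]/(rot P _) flip_rot_dart_at.
    rewrite -[rot P _]/((rot P ^+ 1)%g _) !src_rotX.
    by exists k, (l + 1); split=> //; lia.
  - rewrite flip_rot2_dart_at !src_rotX.
    by exists (k - 1), (l + 1); split=> //; lia.
have [n n6 ->] := src_eq_rotX (esym zu).
have [n3|n3] := ltnP n 3; first exact: out.
(* The three remaining directions reduce to the first three by the half-turn about [src x]. *)
have -> : (rot P ^+ n)%g (dart_at x i j) =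
    (rot P ^+ (n - 3))%g (dart_at x (- i) (- j)).
  by rewrite -rot3_dart_at -permM -expgD subnKC.
have [|k [l [-> kl]]] := out (- i) (- j) (n - 3)%N; first by lia.
exists (- k), (- l); rewrite src_dart_atN; split=> //; lia.
Qed.

Lemma path_dart_at i j s :
  path (@adj P) (src (dart_at x i j)) s ->
  exists i' j', last (src (dart_at x i j)) s = src (dart_at x i' j') /\
    `|j' - j| <= (size s)%:Z.
Proof.
elim: s i j => [|v s IHs] i j /=; first by exists i, j; rewrite subrr.
move=> /andP[/adj_dart_at[i1 [j1 [-> j1j]]] /IHs[i2 [j2 [-> j2j]]]].
exists i2, j2; split=> //; lia.
Qed.

Lemma connect_dart_at v : exists i j, v = src (dart_at x i j).
Proof.
have := graph_connected (src x) v; rewrite -{1}[x]dart_at0.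
move=> /connectP[s s_path ->].
by have [i [j [-> _]]] := path_dart_at s_path; exists i, j.
Qed.

Lemma vertical_path i j n :
  exists s, [/\ path (@adj P) (src (dart_at x i j)) s,
    last (src (dart_at x i j)) s = src (dart_at x i (j - n%:Z)) & size s = n].
Proof.
elim: n j => [|n IHn] j; first by exists [::]; rewrite subr0.
have [s [s_path s_last s_size]] := IHn (j - 1).
exists (src (dart_at x i (j - 1)) :: s); split=> /=; last by rewrite s_size.
  rewrite s_path andbT; apply/existsP.
  exists (flip P (rot P (dart_at x i (j - 1)))).
  rewrite /tgt flipK -[rot P _]/((rot P ^+ 1)%g _) src_rotX eqxx andbT.
  rewrite -[(rot P ^+ 1)%g _]/(rot P _) flip_rot_dart_at.
  by rewrite -[rot P _]/((rot P ^+ 1)%g _) !src_rotX subrK.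
by rewrite s_last; congr (src (dart_at _ _ _)); lia.
Qed.

End HalfTurn.

Lemma bracket_dart q A p :
  bracket c q A p -> exists x, [/\ src x = A, c x = q & (rot P ^+ 3)%g x = x].
Proof.
case=> A3 _ _; have [x xA xq] := class_dart A q.
by exists x; split=> //; apply: rot3_degree3; rewrite xA.
Qed.

(** * Relative position of the two maximal paths of one class *)

Section TwoPaths.

Variables (q : 'Z_3) (A C : vertex P) (pA pC : seq (dart P)) (x y : dart P).
Hypotheses (x_half : (rot P ^+ 3)%g x = x) (y_half : (rot P ^+ 3)%g y = y).
Hypotheses (x_src : src x = A) (y_src : src y = C).
Hypotheses (x_class : c x = q) (y_class : c y = q).
Hypotheses (pA_bracket : bracket c q A pA) (pC_bracket : bracket c q C pC).
Hypothesis pA_neq_pC : ~ (pedges pA =i pedges pC).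

Lemma parallel_height : exists h : nat, exists s : int,
  [/\ (0 < h)%N, y = dart_at x s (- h%:Z)
    & forall j, on_bracket_height x j <-> ((2 * h)%:Z %| j)%Z].
Proof.
have [i0 [j0 yij]] : exists i j, y = dart_at x i j.
  have [i [j Cij]] := connect_dart_at x_half (src y).
  have := src_class_inj (esym Cij); rewrite class_dart_at y_class x_class.
  rewrite rot3_dart_at // => /(_ erefl)[] ->; first by exists i, j.
  by exists (- i), (- j).
(* Otherwise rows 0 and [j0] have the same image, and the two paths the same edges. *)
have j0_off : ~ on_bracket_height x j0.
  move=> [i e]; apply: pA_neq_pC => z.
  have yE k : dart_at y k 0 = dart_at x (i0 + k - i) 0.
    rewrite yij dart_atD -[x in RHS]e dart_atD; congr dart_at; lia.
  apply/idP/idP.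
    move/(mem_pedges_bracket x_half x_src x_class pA_bracket) => [k ->].
    apply/(mem_pedges_bracket y_half y_src y_class pC_bracket).
    by exists (k - i0 + i); rewrite yE; congr dart_at; lia.
  move/(mem_pedges_bracket y_half y_src y_class pC_bracket) => [k ->].
  apply/(mem_pedges_bracket x_half x_src x_class pA_bracket).
  by rewrite yE; eexists.
(* The half-turn also fixes [y], so [(i0, j0)] and its negative give the same dart. *)
have j0_double : on_bracket_height x (j0 + j0).
  exists (i0 + i0).
  have := y_half; rewrite yij rot3_dart_at //.
  move=> /(@dart_at_shift _ _ _ _ _ i0 j0).
  by rewrite !addNr dart_at0.
have [N N_gt0 HN] := on_bracket_height_period x.
have N_neq0 : N%:Z != 0 by lia.
(* The residue [r] of [j0] modulo [N] is nonzero but [2r] is divisible by [N], whence [2r = N]; take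
   [h = r]. *)
have [h [h_gt0 Nh j0h]] : exists h : nat,
    [/\ (0 < h)%N, N = (2 * h)%N & (N%:Z %| j0 + h%:Z)%Z].
  have Nj0 : ~ (N%:Z %| j0)%Z by move/HN.
  move/HN: j0_double => N2.
  have r0 := modz_ge0 j0 N_neq0; have rN := ltz_pmod j0 (N_gt0 : 0 < N%:Z).
  have jE := divz_eq j0 N%:Z.
  set r := (j0 %% N%:Z)%Z in r0 rN jE; set k := (j0 %/ N%:Z)%Z in jE.
  have r_neq0 : r <> 0 by move=> e; apply: Nj0; rewrite jE e addr0 dvdz_mull.
  have : (N%:Z %| r + r - N%:Z)%Z.
    rewrite (_ : r + r - N%:Z = j0 + j0 - (2%:Z * k + 1) * N%:Z).
      by rewrite rpredB // dvdz_mull.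
    by rewrite jE; lia.
  move/dvdz_small => rrN.
  have {}rrN : r + r = N%:Z by apply/eqP; rewrite -subr_eq0; apply/eqP/rrN; lia.
  exists `|r|%N; split; [lia| lia|].
  rewrite jE gez0_abs // -addrA rrN.
  by rewrite rpredD // dvdz_mull.
have [i e] : on_bracket_height x (j0 + h%:Z) by apply/HN.
exists h, (i0 - i); split=> //; last by rewrite -Nh.
rewrite yij -[x in RHS]e dart_atD; congr dart_at; lia.
Qed.

Variables (h : nat) (s : int).
Hypotheses (h_gt0 : (0 < h)%N) (yE : y = dart_at x s (- h%:Z)).
Hypothesis height_mod : forall j, on_bracket_height x j <-> ((2 * h)%:Z %| j)%Z.

(** A vertical path of length [h] joins the two rows. Conversely an edge changes the height by at
    most 1, and the images of the second path have heights that are odd multiples of [h]. *)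
Lemma parallel_distance K : is_distance (pverts A pA) (pverts C pC) K -> K = h.
Proof.
case=> [[u [t [uA ut_path tC <-]]] K_min].
apply/eqP; rewrite eqn_leq; apply/andP; split.
  have [t' [t'_path t'_last <-]] := vertical_path x s 0 h.
  apply: K_min t'_path _.
    apply/(src_dart_at_mem_pverts x_half x_src x_class pA_bracket).
    by exists 0; rewrite dart_at0.
  by rewrite t'_last sub0r -yE y_src mem_head.
move: uA => /(mem_pverts_bracket x_half x_src x_class pA_bracket)[i uE].
move: ut_path tC; rewrite uE => /(path_dart_at x_half)[i1 [j1 [-> j1t]]].
move=> /(mem_pverts_bracket y_half y_src y_class pC_bracket)[k].
have fromE : dart_at y k 0 = dart_at x (s + k) (- h%:Z).
  by rewrite yE dart_atD addr0.
have shift2 i' j' :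
    dart_at x i1 j1 = dart_at x i' j' -> ((2 * h)%:Z %| j1 - j')%Z.
  move/(@dart_at_shift _ _ _ _ _ (- i') (- j')); rewrite !subrr dart_at0 => e.
  by apply/height_mod; exists (i1 - i').
have close e : ((2 * h)%:Z %| e)%Z -> `|e| < (2 * h)%:Z -> e = 0.
  by move=> /dvdz_small e0 lt; apply: e0; lia.
rewrite fromE => /esym/(src_dart_at_inj x_half)[] /shift2 /close; lia.
Qed.

(** The walk first meets the path at its vertex number [h], so the edge entering that vertex, number
    [h.-1], is the first adjacent one. *)
Lemma first_adjacent_dart z n f :
  (forall k : nat,
     src (iter k a z) \in pverts A pA <-> ((2 * h)%:Z %| k%:Z - h%:Z)%Z) ->
  c z <> q -> first_adjacent A pA (traject a z n) f -> f = iter h.-1 a z.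
Proof.
move=> z_height z_class; rewrite /first_adjacent.
have adjE (k : nat) : adjacent A pA (iter k a z) =
    (src (iter k a z) \in pverts A pA) || (src (iter k.+1 a z) \in pverts A pA).
  rewrite /adjacent tgt_east -iterS andb_idl // => _; apply/negP.
  move/(mem_pedges_bracket x_half x_src x_class pA_bracket) => [i e].
  apply: z_class; rewrite -x_class -(class_dart_at x i 0) -e.
  by rewrite east_dart_at class_dart_at.
have hit : adjacent A pA (iter h.-1 a z).
  rewrite adjE; apply/orP; right; apply/z_height; rewrite prednK // subrr.
  exact: dvdz0.
have miss (k : nat) : (k < h.-1)%N -> adjacent A pA (iter k a z) = false.
  move=> kh; rewrite adjE; apply/norP.
  split; apply/negP=> /z_height/dvdz_small; lia.
(* No bound relating [n] to [h] is required: a walk ending too early has no adjacent edge, contrary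
   to the existence of [f]. *)
have: forall m, (m <= h.-1)%N ->
    ohead [seq e <- traject a (iter m a z) n | adjacent A pA e] = Some f ->
    f = iter h.-1 a z.
  elim: n => [|n IHn] m mh //=.
  have [mh'|] := ltnP m h.-1; first by rewrite miss // -iterS; apply: IHn.
  by move=> hm; have -> : m = h.-1 by [lia|]; rewrite hit => -[].
by move/(_ 0%N isT).
Qed.

End TwoPaths.

(** * Left and right branches in lattice coordinates *)

Section BranchOffset.

Variables (q : 'Z_3) (A : vertex P) (p : seq (dart P)) (x : dart P).
Hypothesis x_half : (rot P ^+ 3)%g x = x.
Hypotheses (x_src : src x = A) (x_class : c x = q).
Hypothesis p_bracket : bracket c q A p.

(** If [dart_at x s 0] points forward at index [i], the branch lies on the left and [s] is [i]
    modulo the period; if backward, it lies on the right and [s] is [-i]. The offsets [i] and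
    [size p - i] match [s] modulo [size p]. *)
Lemma branch_offset_mod (n : nat) s e :
  n \in [:: 1; 2]%N -> branch_dart A p e = (rot P ^+ n)%g (dart_at x s 0) ->
  ((size p)%:Z %| (branch_offset A p e)%:Z - s)%Z.
Proof.
move=> n12 eE.
rewrite /branch_offset /branch_value /left_branch.
have [m_gt0 m_end] := bracket_end x_half x_src x_class p_bracket.
have period := bracket_period x_half x_src x_class p_bracket.
have dart_m i j : dart_at x i 0 = dart_at x j 0 -> ((2 * size p)%:Z %| i - j)%Z.
  move/(@dart_at_shift _ _ _ _ _ (- j) 0); rewrite (subrr j) !addr0 dart_at0.
  by move/period.
have half_dvd i : ((2 * size p)%:Z %| i)%Z -> ((size p)%:Z %| i)%Z.
  by move=> /dvdzP[k ->]; rewrite PoszM mulrA dvdz_mull.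
have [i im ei] : exists2 i, (i <= size p)%N & branch_index A p e = i /\
    (dart_at x s 0 = dart_at x i%:Z 0 \/ dart_at x s 0 = dart_at x (- i%:Z) 0).
  have e_in : src (branch_dart A p e) \in pverts A p.
    rewrite eE src_rotX.
    apply/(mem_pverts_bracket x_half x_src x_class p_bracket).
    by exists s.
  exists (branch_index A p e).
    by have := e_in; rewrite -index_mem size_pverts ltnS.
  have := e_in; rewrite -index_mem size_pverts ltnS => le.
  split=> //; have := nth_index A e_in; rewrite -/(branch_index A p e).
  rewrite (nth_pverts_bracket x_half x_src x_class p_bracket) // eE src_rotX.
  by move/(src_dart_at_inj x_half); rewrite oppr0.
case: ei => -> ei; rewrite eE.
set d := dart_at x s 0 in ei eE *.
have class_d : c d = q by rewrite class_dart_at.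
have class_p z (k : nat) : (k < size p)%N -> c (nth z p k) = q.
  move=> kp; rewrite (nth_bracket x_half x_src x_class p_bracket) //.
  by rewrite class_dart_at.
have near : dart_at x i%:Z 0 = d -> ((size p)%:Z %| i%:Z - s)%Z.
  by move/dart_m/half_dvd.
have far : dart_at x i%:Z 0 <> d ->
    ((size p)%:Z %| (2 * size p - i - size p)%:Z - s)%Z.
  case: ei => [<- //|/dart_m/half_dvd si _].
  rewrite (_ : _ - s = (size p)%:Z - (s - - i%:Z)); last by lia.
  by rewrite rpredB // dvdzz.
(* Comparing classes excludes one disjunct of [left_branch]: for [n = 1] only the outgoing edge of
   the path can match, for [n = 2] only the incoming one. *)
have class_neq z w (l : nat) :
    l \in [:: 1; 2]%N -> c z = c w + l%:R -> (z == w) = false.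
  move=> l12 cz; apply/eqP => zw; move: cz; rewrite zw -{1}(addr0 (c w)).
  by move/addrI/eqP; move: l12; rewrite !inE => /orP[] /eqP->.
move: n12; rewrite !inE => /orP[] /eqP n12; rewrite {}n12.
  rewrite [X in _ || X](_ : _ = false) ?orbF; last first.
    apply/negP => /andP[/andP[i_gt0 _]]; apply/negP.
    rewrite (class_neq _ _ 2%N) // -[rot P _]/((rot P ^+ 1)%g _) !class_rotX.
    by rewrite class_flip class_p ?prednK // class_d -addrA -natrD.
  have [i_lt|i_ge] := ltnP i (size p) => /=.
    rewrite (nth_bracket x_half x_src x_class p_bracket) //.
    by rewrite (inj_eq perm_inj); case: eqP.
  (* At the terminal vertex there is no outgoing edge and the branch counts as right; its offset 0
     agrees with [i = size p] modulo [size p]. *)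
  have [id|] := eqVneq (dart_at x i%:Z 0) d; last by move/eqP/far.
  rewrite (_ : _ - s = i%:Z - s - (size p)%:Z); last by lia.
  by rewrite rpredB ?near ?dvdzz.
rewrite [X in X || _](_ : _ = false) /=; last first.
  apply/negP => /andP[i_lt]; apply/negP.
  rewrite eq_sym (class_neq _ _ 1%N) // -[rot P _]/((rot P ^+ 1)%g _).
  by rewrite !class_rotX class_p // class_d -addrA -natrD.
(* At the initial vertex there is no incoming edge; the offset is then [size p], congruent to
   [i = 0]. *)
have [i0|i_gt0] := posnP i.
  rewrite /=; have [id|] := eqVneq (dart_at x i%:Z 0) d; last by move/eqP/far.
  rewrite (_ : _ - s = i%:Z - s + (size p)%:Z); last by lia.
  by rewrite rpredD ?near ?dvdzz.
rewrite im /= (nth_bracket x_half x_src x_class p_bracket) ?prednK //.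
rewrite flip_dart_at_half //.
(* The reversed incoming edge is the half-turn of the forward dart, so this test too compares [d]
   with that dart. *)
rewrite (_ : dart_at x _ _ = (rot P ^+ 3)%g (dart_at x i%:Z 0)).
  rewrite -permM -expgSr (inj_eq perm_inj) eq_sym.
  by case: eqP => [/near|/far].
by rewrite rot3_dart_at //; congr dart_at; lia.
Qed.

End BranchOffset.
End Classes.

End Charts.

(** * Coordinates of the edges [f] and [g], and the resulting congruence *)

Theorem theorem2p1 (P : plane_graph) (c : dart P -> 'Z_3) (q : 'Z_3)
    (A C : vertex P) (pA pC pCplus pCminus : seq (dart P)) (f g : dart P)
    (M K Splus Sminus : nat) :
  in_family P -> edge_classes c ->
  (* pA = [A,q] and pC = [C,q] are the two maximal paths of class q *)
  bracket c q A pA -> bracket c q C pC -> ~ (pedges pA =i pedges pC) ->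
  M = size pA ->
  is_distance (pverts A pA) (pverts C pC) K ->
  bracket c (q + 1) C pCplus -> first_adjacent A pA pCplus f ->
  Splus = branch_offset A pA f ->
  bracket c (q - 1) C pCminus -> first_adjacent A pA pCminus g ->
  Sminus = branch_offset A pA g ->
  (Sminus%:Z - Splus%:Z = K%:Z %[mod M%:Z])%Z.
Proof.
move=> famP clP brA brC neq -> distK brp adjf -> brm adjg ->.
have [x [xA xq x3]] := bracket_dart famP clP brA.
have [y [yC yq y3]] := bracket_dart famP clP brC.
have [h [s [h_gt0 yE heights]]] :=
  parallel_height famP clP x3 y3 xA yC xq yq brA brC neq.
rewrite (parallel_distance famP clP x3 y3 xA yC xq yq brA brC h_gt0 yE
  heights distK).
have C3 : degree C = 3%N by case: brC.
have turn n : [/\ src ((Defs.rot P ^+ n)%g y) = C,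
    c ((Defs.rot P ^+ n)%g y) = q + n%:R
    & (Defs.rot P ^+ 3)%g ((Defs.rot P ^+ n)%g y) = (Defs.rot P ^+ n)%g y].
  split; first by rewrite src_rotX.
    by rewrite class_rotX // yq.
  by apply: rot3_degree3; rewrite src_rotX yC.
have mem_A i j : src (dart_at x i j) \in pverts A pA <-> ((2 * h)%:Z %| j)%Z.
  rewrite -heights; exact: (src_dart_at_mem_pverts famP clP x3 xA xq brA).
(* Row -1 misses the path because [2h] does not divide -1, so the dart leaving the path is the
   flip. *)
have branch_dartE n i e :
    e = (Defs.rot P ^+ n)%g (dart_at x i (- 1)) ->
    branch_dart A pA e = flip P e.
  move=> ->; rewrite /branch_dart src_rotX.
  case: ifP => // /mem_A/dvdz_small; lia.
(* [f] climbs from row -1 to [(s, 0)]; its flip involves a half-turn, which changes [s] to [-s]. *)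
have fP : ((size pA)%:Z %| (branch_offset A pA f)%:Z - (- s))%Z.
  have [zC zq z3] := turn 1%N.
  apply: (branch_offset_mod famP clP x3 xA xq brA (n := 1)) => //.
  move: adjf; rewrite (bracket_traject famP clP z3 zC zq brp).
  have stepE k : iter k (east (flip P) (Defs.rot P)) ((Defs.rot P ^+ 1)%g y) =
      (Defs.rot P ^+ 1)%g (dart_at x s (- h%:Z + k%:Z)).
    by rewrite yE -[RHS](east_rot_dart_at famP).
  move=> /(first_adjacent_dart famP clP x3 xA xq brA h_gt0) fE.
  have {}fE : f = (Defs.rot P ^+ 1)%g (dart_at x s (- 1)).
    rewrite fE.
    - by rewrite stepE; congr (fun_of_perm _ (dart_at _ _ _)); lia.
    - by move=> k; rewrite stepE src_rotX [- h%:Z + _]addrC.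
    by rewrite zq -[RHS]addr0 => /addrI/eqP.
  rewrite (branch_dartE 1%N s) // fE.
  rewrite [LHS](flip_rot_dart_at famP) rot3_dart_at //.
(* Each step in the class [q - 1] direction also lowers the first coordinate, so [g] arrives at
   [(s - h, 0)], and the half-turn gives [h - s]. *)
have gP : ((size pA)%:Z %| (branch_offset A pA g)%:Z - (h%:Z - s))%Z.
  have [zC zq z3] := turn 2%N.
  apply: (branch_offset_mod famP clP x3 xA xq brA (n := 2)) => //.
  have q2 : q + 2%:R = q - 1 by congr (q + _); apply: val_inj.
  rewrite q2 in zq.
  move: adjg; rewrite (bracket_traject famP clP z3 zC zq brm).
  have stepE k : iter k (east (flip P) (Defs.rot P)) ((Defs.rot P ^+ 2)%g y) =
      (Defs.rot P ^+ 2)%g (dart_at x (s - k%:Z) (- h%:Z + k%:Z)).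
    by rewrite yE (east_rot2_dart_at famP).
  move=> /(first_adjacent_dart famP clP x3 xA xq brA h_gt0) gE.
  have {}gE : g = (Defs.rot P ^+ 2)%g (dart_at x (s - h%:Z + 1) (- 1)).
    rewrite gE.
    - by rewrite stepE; congr (fun_of_perm _ (dart_at _ _ _)); lia.
    - by move=> k; rewrite stepE src_rotX [- h%:Z + _]addrC.
    by rewrite zq -[RHS]addr0 => /addrI/eqP.
  rewrite (branch_dartE 2%N (s - h%:Z + 1)) // gE.
  rewrite (flip_rot2_dart_at famP) rot3_dart_at //.
  congr (fun_of_perm _ (dart_at _ _ _)); lia.
apply/eqP; rewrite eqz_mod_dvd.
rewrite (_ : _ - h%:Z = (branch_offset A pA g)%:Z - (h%:Z - s) -
  ((branch_offset A pA f)%:Z - (- s))); last by lia.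
by rewrite rpredB.
Qed.
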